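(* Let $n\ge2$. Let $A_1=\{1\text{-}23\}$, $A_2=\{2\text{-}13,21\text{-}3\}$, $A_3=\{1\text{-}32,13\text{-}2\}$, $A_4=\{3\text{-}12,31\text{-}2\}$. For every choice of $p_i\in A_i$ ($i=1,2,3,4$), $|S_n(p_1,p_2,p_3,p_4)|=2$ and $$S_n(p_1,p_2,p_3,p_4)=\{\,n\,(n-1)\ldots 3\,2\,1,\ \ (n-1)\,n\,(n-2)\,(n-3)\ldots 2\,1\,\}.$$
   Context: $S_n$ is the set of permutations $\pi=\pi_1\pi_2\cdots\pi_n$ of $\{1,\dots,n\}$ (written in one-line notation). For $abc$ a permutation of $123$, the generalized pattern $a\text{-}bc$ is contained in $\pi$ if there are indices $i<j$ with $j+1\le n$ such that $\pi_i\pi_j\pi_{j+1}$ is order-isomorphic to $abc$; the generalized pattern $ab\text{-}c$ is contained in $\pi$ if there are indices $i,k$ with $i+1<k\le n$ such that $\pi_i\pi_{i+1}\pi_k$ is order-isomorphic to $abc$. $\pi$ avoids a pattern if it does not contain it. $S_n(p_1,\dots,p_m)$ is the set of $\pi\in S_n$ avoiding all of $p_1,\dots,p_m$. *)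

(* Defs.v *)
From HB Require Import structures.
From mathcomp Require Import all_boot all_fingroup.

Set Implicit Arguments.
Unset Strict Implicit.
Unset Printing Implicit Defensive.

(* [dash1 a b c] is the generalized pattern a-bc, [dash2 a b c] is ab-c. *)
Inductive gpattern : Type :=
| dash1 of nat & nat & nat
| dash2 of nat & nat & nat.

Definition gpattern_code (p : gpattern) : bool * nat * nat * nat :=
  match p with
  | dash1 a b c => (true, a, b, c)
  | dash2 a b c => (false, a, b, c)
  end.

Definition gpattern_decode (x : bool * nat * nat * nat) : gpattern :=
  let: (d, a, b, c) := x in if d then dash1 a b c else dash2 a b c.

Lemma gpattern_codeK : cancel gpattern_code gpattern_decode.
Proof. by case. Qed.

HB.instance Definition _ := Equality.copy gpattern (can_type gpattern_codeK).

Definition order_isomorphic (u v : seq nat) : bool :=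
  (size u == size v) &&
  [forall i : 'I_(size u), forall j : 'I_(size u),
     (nth 0 u i < nth 0 u j) == (nth 0 v i < nth 0 v j)].

(* 'S_n permutes {0, ..., n-1}; the letters are shifted to {1, ..., n}. *)
Definition one_line (n : nat) (pi : 'S_n) : seq nat :=
  [seq (pi i).+1 | i <- enum 'I_n].

(* Positions are 0-based: the last letter is at position n - 1. *)
Definition contains (n : nat) (pi : 'S_n) (p : gpattern) : bool :=
  let w := one_line pi in
  match p with
  | dash1 a b c =>
      [exists i : 'I_n, exists j : 'I_n,
        [&& i < j, j.+1 < n &
          order_isomorphic [:: nth 0 w i; nth 0 w j; nth 0 w j.+1]
                           [:: a; b; c]]]
  | dash2 a b c =>
      [exists i : 'I_n, exists k : 'I_n,
        (i.+1 < k) &&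
          order_isomorphic [:: nth 0 w i; nth 0 w i.+1; nth 0 w k]
                           [:: a; b; c]]
  end.

Definition avoids (n : nat) (pi : 'S_n) (p : gpattern) : bool :=
  ~~ contains pi p.

Definition avoiders (n : nat) (ps : seq gpattern) : {set 'S_n} :=
  [set pi : 'S_n | all (avoids pi) ps].

Definition A1 : seq gpattern := [:: dash1 1 2 3].
Definition A2 : seq gpattern := [:: dash1 2 1 3; dash2 2 1 3].
Definition A3 : seq gpattern := [:: dash1 1 3 2; dash2 1 3 2].
Definition A4 : seq gpattern := [:: dash1 3 1 2; dash2 3 1 2].

Definition decreasing_word (k : nat) : seq nat := rev (iota 1 k).

(* Main.v *)
(** In every pattern from [A1], ..., [A4] the
    last letter is not the smallest, so a permutation in which every letter
    from the third on is smaller than all its predecessors avoids all of them.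
    Conversely, three consecutive letters whose last one is not the smallest
    form 123, 213, 132 or 312, and then both the a-bc and the ab-c version of
    this pattern occur; hence an avoider has that property. Such a word is
    decreasing, possibly after its first two letters are exchanged. *)
Require Import Defs.
From mathcomp Require Import all_boot all_fingroup zify.

(** Diagonal comparisons are false on both sides, so six remain; in this form [lia] can reason about
    patterns. *)
Lemma order_isomorphic3 (x y z a b c : nat) :
  order_isomorphic [:: x; y; z] [:: a; b; c] =
  [&& (x < y) == (a < b), (y < x) == (b < a), (x < z) == (a < c),
      (z < x) == (c < a), (y < z) == (b < c) & (z < y) == (c < b)].
Proof.
rewrite /order_isomorphic eqxx /=; apply/idP/idP.
  move=> /forallP iso.
  have H i j : i < 3 -> j < 3 ->
    (nth 0 [:: x; y; z] i < nth 0 [:: x; y; z] j) ==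
    (nth 0 [:: a; b; c] i < nth 0 [:: a; b; c] j).
    by move=> hi hj; have /forallP/(_ (Ordinal hj)) := iso (Ordinal hi).
  by rewrite (H 0 1) // (H 1 0) // (H 0 2) // (H 2 0) // (H 1 2) // (H 2 1).
case/and5P=> h1 h2 h3 h4 /andP[h5 h6].
by apply/forallP=> -[[|[|[|i]]] hi] //; apply/forallP=> -[[|[|[|j]]] hj] //=;
  rewrite ?ltnn.
Qed.

(** * Permutations as rearrangements of [iota 1 n] *)

Lemma size_one_line n (pi : 'S_n) : size (one_line pi) = n.
Proof. by rewrite size_map size_enum_ord. Qed.

Lemma nth_one_line n (pi : 'S_n) (i : 'I_n) :
  nth 0 (one_line pi) i = (pi i).+1.
Proof. by rewrite (nth_map i) ?size_enum_ord // nth_ord_enum. Qed.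

Lemma one_line_inj n : injective (@one_line n).
Proof.
move=> s t est; apply/permP=> i; apply: val_inj; apply: succn_inj.
by rewrite -!nth_one_line est.
Qed.

Lemma uniq_one_line n (pi : 'S_n) : uniq (one_line pi).
Proof.
by rewrite map_inj_uniq ?enum_uniq // => i j [/val_inj/perm_inj].
Qed.

Lemma perm_one_line n (pi : 'S_n) : perm_eq (one_line pi) (iota 1 n).
Proof.
have sub : {subset one_line pi <= iota 1 n}.
  by move=> x /mapP[i _ ->]; rewrite mem_iota add1n !ltnS leq0n ltn_ord.
apply: uniq_perm; rewrite ?uniq_one_line ?iota_uniq //.
have [] // := uniq_min_size (uniq_one_line _ pi) sub.
by rewrite size_iota size_one_line.
Qed.

Lemma one_line_surj n (w : seq nat) :
  perm_eq w (iota 1 n) -> exists pi : 'S_n, one_line pi = w.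
Proof.
(* The empty word is treated apart because [inord] below needs a nonempty ordinal type. *)
case: n => [|n] hw.
  exists 1%g; rewrite (perm_small_eq _ hw) ?size_iota //; apply: size0nil.
  exact: size_one_line.
have sw : size w = n.+1 by rewrite (perm_size hw) size_iota.
have bw (i : 'I_n.+1) : 0 < nth 0 w i <= n.+1.
  have : nth 0 w i \in iota 1 n.+1 by rewrite -(perm_mem hw) mem_nth ?sw.
  by rewrite mem_iota; lia.
(* By [bw] the letter minus one is at most [n], so [inord] never falls back on its default. *)
pose f (i : 'I_n.+1) : 'I_n.+1 := inord (nth 0 w i).-1.
have fE i : (f i).+1 = nth 0 w i.
  by have bi := bw i; rewrite inordK; lia.
have f_inj : injective f.
  move=> i j fij; apply: val_inj; apply/eqP.
  have : nth 0 w i == nth 0 w j by rewrite -!fE fij.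
  by rewrite nth_uniq ?sw ?(perm_uniq hw) ?iota_uniq.
exists (perm f_inj); apply: (@eq_from_nth _ 0); rewrite size_one_line ?sw //.
by move=> i hi; rewrite (nth_one_line _ _ (Ordinal hi)) permE fE.
Qed.

Definition min_from_third (w : seq nat) : Prop :=
  forall i k, i < k -> 2 <= k -> k < size w -> nth 0 w k < nth 0 w i.

Lemma min_from_thirdP (a b : nat) (t : seq nat) :
  min_from_third [:: a, b & t] <-> path gtn a t /\ path gtn b t.
Proof.
have gtn_trans : transitive gtn by move=> x y z /= hxy hzx; lia.
split=> [h|[ha hb]].
  split; apply/(pathP 0) => i hi /=.
    by case: i hi => [|i] hi; [apply: (h 0 2)|apply: (h i.+2 i.+3)].
  exact: (h i.+1 i.+2).
have lt_nth c j : path gtn c t -> j < size t -> nth 0 t j < c.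
  rewrite path_sortedE // => /andP[/allP h _] hj.
  by apply: h; apply: mem_nth.
move=> i [|[|k]] //= hik _ hk.
case: i hik => [|[|i]] /= hik; [exact: lt_nth | exact: lt_nth |].
by apply: (sorted_ltn_nth gtn_trans 0 (path_sorted ha));
  rewrite ?inE //; lia.
Qed.

(** Induction on the later position: its letter lies below its left neighbour, which from the third
    position on already lies below everything before it. *)
Lemma min_from_third_triples (w : seq nat) :
  (forall j, j.+2 < size w ->
     nth 0 w j.+2 < nth 0 w j /\ nth 0 w j.+2 < nth 0 w j.+1) ->
  min_from_third w.
Proof.
move=> h i [|[|k]] //; elim: k i => [|k IH] i hik _ hk.
  by case: i hik => [|[|i]] // _; have [] := h 0 hk.
have [_ lt_last] := h k.+1 hk.
have [->//|ne] := eqVneq i k.+2.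
by apply: (ltn_trans lt_last); apply: IH; lia.
Qed.

(** Adjacent positions satisfy the adjacency condition of both kinds of pattern, so the choice
    between a-bc and ab-c will not matter. *)
Lemma consecutive_contains n (pi : 'S_n) (a b c j : nat) :
  j.+2 < n ->
  order_isomorphic [:: nth 0 (one_line pi) j; nth 0 (one_line pi) j.+1;
                       nth 0 (one_line pi) j.+2] [:: a; b; c] ->
  contains pi (dash1 a b c) && contains pi (dash2 a b c).
Proof.
move=> hj iso; have hj1 : j.+1 < n by lia.
have hj0 : j < n by lia.
apply/andP; split; apply/existsP; exists (Ordinal hj0); apply/existsP.
  by exists (Ordinal hj1) => /=; rewrite iso hj ltnSn.
by exists (Ordinal hj) => /=; rewrite iso ltnSn.
Qed.

Lemma min_from_third_avoids n (pi : 'S_n) (p : gpattern) :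
  p \in A1 ++ A2 ++ A3 ++ A4 -> min_from_third (one_line pi) -> avoids pi p.
Proof.
move=> hp hmin; apply/negP => cont.
have lt_w i k : i < k -> 2 <= k -> k < n ->
    nth 0 (one_line pi) k < nth 0 (one_line pi) i.
  by move=> *; apply: hmin; rewrite ?size_one_line.
move: hp cont; rewrite !inE => /or4P[|||/or4P[]] => [/eqP->|/eqP->|/eqP->
  |/eqP->|/eqP->|/eqP->|/eqP->].
all: rewrite /contains => /existsP[i /existsP[k]].
(* These are the a-bc patterns, whose last letter is at [k.+1]; in the remaining ab-c cases it is at
   [k]. Either way that position is at least 2. *)
1,2,4,6: case/and3P=> hik hk; rewrite order_isomorphic3;
  have := lt_w i k.+1; have := lt_w k k.+1; lia.
all: case/andP=> hik; rewrite order_isomorphic3;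
  have := lt_w i k; have := lt_w i.+1 k; have := ltn_ord k; lia.
Qed.

(** Among the six orderings of three distinct letters, only 231 and 321 survive, and both end in
    their minimum. *)
Lemma last_min_of_patterns (x y z : nat) :
  x != y -> x != z -> y != z ->
  ~~ order_isomorphic [:: x; y; z] [:: 1; 2; 3] ->
  ~~ order_isomorphic [:: x; y; z] [:: 2; 1; 3] ->
  ~~ order_isomorphic [:: x; y; z] [:: 1; 3; 2] ->
  ~~ order_isomorphic [:: x; y; z] [:: 3; 1; 2] ->
  z < x /\ z < y.
Proof.
rewrite !order_isomorphic3.
by case: (ltngtP x y) => // ?; case: (ltngtP x z) => // ?;
  case: (ltngtP y z) => // ?; lia.
Qed.

Lemma avoids_min_from_third n (pi : 'S_n) (p1 p2 p3 p4 : gpattern) :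
  p1 \in A1 -> p2 \in A2 -> p3 \in A3 -> p4 \in A4 ->
  all (avoids pi) [:: p1; p2; p3; p4] -> min_from_third (one_line pi).
Proof.
move=> h1 h2 h3 h4 /and5P[av1 av2 av3 av4 _].
apply: min_from_third_triples => j; rewrite size_one_line => hj.
(* Avoiding one member of each pair refutes the conjunction that three consecutive letters would
   produce. *)
have n123 : ~~ (contains pi (dash1 1 2 3) && contains pi (dash2 1 2 3)).
  by move: h1 av1; rewrite inE => /eqP-> /negPf; rewrite negb_and => ->.
have n213 : ~~ (contains pi (dash1 2 1 3) && contains pi (dash2 2 1 3)).
  rewrite negb_and.
  by move: h2 av2; rewrite !inE /avoids => /orP[]/eqP-> ->; rewrite ?orbT.
have n132 : ~~ (contains pi (dash1 1 3 2) && contains pi (dash2 1 3 2)).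
  rewrite negb_and.
  by move: h3 av3; rewrite !inE /avoids => /orP[]/eqP-> ->; rewrite ?orbT.
have n312 : ~~ (contains pi (dash1 3 1 2) && contains pi (dash2 3 1 2)).
  rewrite negb_and.
  by move: h4 av4; rewrite !inE /avoids => /orP[]/eqP-> ->; rewrite ?orbT.
have iso abc := @consecutive_contains n pi abc.1.1 abc.1.2 abc.2 j hj.
apply: last_min_of_patterns.
4: exact: contraNN (iso (1, 2, 3)) n123.
4: exact: contraNN (iso (2, 1, 3)) n213.
4: exact: contraNN (iso (1, 3, 2)) n132.
4: exact: contraNN (iso (3, 1, 2)) n312.
all: by rewrite nth_uniq ?size_one_line ?uniq_one_line ?(ltnW (ltnW hj))
  ?(ltnW hj) // neq_ltn ltnS ?leqnSn ?leqnn.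
Qed.

Lemma decreasing_wordS k :
  decreasing_word k.+1 = k.+1 :: decreasing_word k.
Proof. by rewrite /decreasing_word -{1}[k.+1]addn1 iotaD rev_cat add1n. Qed.

Lemma sorted_decreasing_word k : sorted gtn (decreasing_word k).
Proof. by rewrite /decreasing_word rev_sorted; apply: iota_ltn_sorted. Qed.

Lemma sorted_gtn_perm_iota (w : seq nat) k :
  sorted gtn w -> perm_eq w (iota 1 k) -> w = decreasing_word k.
Proof.
move=> sw pw; apply: (@sorted_eq _ gtn) => //.
- by move=> x y z /= hxy hzx; lia.
- by move=> x y /=; lia.
- exact: sorted_decreasing_word.
- by rewrite (perm_trans pw) // perm_sym perm_rev.
Qed.

Lemma perm_swap2 (T : eqType) (a b : T) (t : seq T) :
  perm_eq [:: a, b & t] [:: b, a & t].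
Proof. by apply/seq.permP=> p /=; rewrite addnCA. Qed.

Lemma min_from_third_words m (w : seq nat) :
  perm_eq w (iota 1 m.+2) ->
  min_from_third w <->
  w \in [:: decreasing_word m.+2; [:: m.+1, m.+2 & decreasing_word m]].
Proof.
move=> pw; rewrite !inE; split; last first.
  have := sorted_decreasing_word m.+2; rewrite !decreasing_wordS /=.
  move=> /andP[_ p1].
  (* Raising the starting bound from [m.+1] keeps the path decreasing; [p1] and [p2] then serve both
     orders of the first two letters. *)
  have p2 : path gtn m.+2 (decreasing_word m).
    have := sorted_decreasing_word m; move: p1.
    by case: (decreasing_word m) => //= x s /andP[h ->] _; lia.
  by case/orP=> /eqP->; apply/min_from_thirdP.
have := perm_size pw; rewrite size_iota; case: w pw => [|a [|b t]] // pw _.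
move=> /min_from_thirdP[pa pb].
have : a != b.
  by have := perm_uniq pw; rewrite iota_uniq /= inE negb_or => /and3P[/andP[]].
rewrite neq_ltn => /orP[ltab|ltba].
  (* Here [pa] puts [a] above the tail, so the exchanged word is decreasing and thus determined by
     its letters. *)
  have : [:: b, a & t] = decreasing_word m.+2.
    apply: sorted_gtn_perm_iota; first by rewrite /= ltab.
    by apply: perm_trans pw; apply: perm_swap2.
  by rewrite !decreasing_wordS => -[-> -> ->]; rewrite eqxx orbT.
have -> : [:: a, b & t] = decreasing_word m.+2.
  by apply: sorted_gtn_perm_iota; rewrite //= ltba.
by rewrite eqxx.
Qed.

Theorem proposition2p6 (n : nat) (hn : 2 <= n) (p1 p2 p3 p4 : gpattern)
  (h1 : p1 \in A1) (h2 : p2 \in A2) (h3 : p3 \in A3) (h4 : p4 \in A4) :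
  #|avoiders n [:: p1; p2; p3; p4]| = 2 /\
  [seq one_line pi | pi in avoiders n [:: p1; p2; p3; p4]] =i
    [:: decreasing_word n; [:: n - 1, n & decreasing_word (n - 2)]].
Proof.
case: n hn => [|[|m]] // _; rewrite subn1 !subSS subn0 /=.
set words := [:: decreasing_word _; _].
have avP pi : pi \in avoiders m.+2 [:: p1; p2; p3; p4] <->
    one_line pi \in words.
  rewrite inE -(min_from_third_words _ _ (perm_one_line _ pi)).
  split; first exact: avoids_min_from_third.
  by move=> hmin; apply/allP => p; rewrite !inE => /or4P[]/eqP->;
    apply: min_from_third_avoids hmin; rewrite !mem_cat ?h1 ?h2 ?h3 ?h4 ?orbT.
have perm_words w : w \in words -> perm_eq w (iota 1 m.+2).
  have pd : perm_eq (decreasing_word m.+2) (iota 1 m.+2).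
    by rewrite /decreasing_word perm_rev.
  rewrite !inE => /orP[]/eqP-> //.
  by apply: perm_trans (perm_swap2 _ _ _ _) _; rewrite -!decreasing_wordS.
have eq_words :
    [seq one_line pi | pi in avoiders m.+2 [:: p1; p2; p3; p4]] =i words.
  move=> w; apply/imageP/idP => [[pi /avP hpi ->] //|hw].
  have [pi def_w] := one_line_surj _ _ (perm_words w hw).
  by exists pi => //; apply/avP; rewrite def_w.
(* The cardinality is the length of the image list, which is duplicate-free by injectivity; the two
   words differ in their first letter. *)
split=> //; rewrite -(size_image (@one_line m.+2)).
rewrite (perm_size (uniq_perm _ _ eq_words)) //.
  by rewrite map_inj_uniq ?enum_uniq //; apply: one_line_inj.
by rewrite /words !decreasing_wordS /= inE andbT eqseq_cons; lia.
Qed.
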